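(* Let $d\ge 2$ be a fixed integer and let $\delta\ge 0$, $\beta\in\mathbb R$ be constants with $$\delta<\tfrac{d-1}{d+1},\qquad \beta<\tfrac{2\delta}{d(d-1)}+\tfrac{d-2}{d}.$$ Let $s=s_n=n^{-(d-1)+\delta+o(1)}$, $q=q_n=n^{-1+\beta+o(1)}$, and $q\le p=p_n\le 1$. Let $(\mathcal H,A)\sim\mathbb P$ be sampled from the noisy projection model defined in the context, and let $$\widehat{\mathcal H}=\widehat{\mathcal H}(A)=\{\Psi\subset[n]:|\Psi|=d,\ (i,j)\in A\text{ for all distinct } i,j\in\Psi\}$$ be the set of $d$-cliques of $A$. Then, as $n\to\infty$: (i) if $p=1-o(1)$, then $\mathbb E_{\mathbb P}\big[|\widehat{\mathcal H}\,\triangle\,\mathcal H|\big]=o(1)\cdot s\binom nd$; (ii) if $p=\Omega(1)$, then $\mathbb E_{\mathbb P}\big[|\widehat{\mathcal H}\,\triangle\,\mathcal H|\big]=(1-\Omega(1))\cdot s\binom nd$, i.e. there is a constant $c>0$ such that $\mathbb E_{\mathbb P}[|\widehat{\mathcal H}\,\triangle\,\mathcal H|]\le(1-c)\,s\binom nd$ for all sufficiently large $n$.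
   Context: Model. $\operatorname U_{n,d}$ is the collection of all $d$-element subsets of $[n]=\{1,\dots,n\}$. The random $d$-uniform hypergraph $\mathcal H$ on $[n]$ (identified with its set of hyperedges) includes each $\Psi\in \operatorname U_{n,d}$ independently with probability $s\in[0,1]$. The projection $\mathcal P(\mathcal H)$ is the graph on $[n]$ in which an unordered pair $(i,j)$, $i\ne j$, is an edge if and only if some $\Psi\in\mathcal H$ contains both $i$ and $j$. Under $\mathbb P$: first sample $\mathcal H$; then, conditionally on $\mathcal H$, the random graph $A$ on $[n]$ includes, independently over pairs, each pair $(i,j)\in\mathcal P(\mathcal H)$ with probability $p$ and each pair $(i,j)\notin\mathcal P(\mathcal H)$ with probability $q$. $\triangle$ denotes symmetric difference of sets of hyperedges. All asymptotics are as $n\to\infty$ with $d,\beta,\delta$ fixed. *)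

(* Defs.v *)
From HB Require Import structures.
From mathcomp Require Import all_boot all_order all_algebra.
From mathcomp Require Import all_classical all_reals all_analysis.
Import Order.TTheory GRing.Theory Num.Theory.
Import numFieldNormedType.Exports.
Set Implicit Arguments.
Unset Strict Implicit.
Unset Printing Implicit Defensive.
Local Open Scope ring_scope.

(* The vertex set [n] is 'I_n. Hypergraphs are sets of d-subsets of 'I_n and
   graphs are sets of 2-subsets of 'I_n, so both have type {set {set 'I_n}}. *)
Definition dsubsets (n d : nat) : {set {set 'I_n}} :=
  [set Psi : {set 'I_n} | #|Psi| == d].

Definition projection (n : nat) (H : {set {set 'I_n}}) : {set {set 'I_n}} :=
  [set e in dsubsets n 2 | [exists Psi in H, e \subset Psi]].

Definition cliques (n d : nat) (A : {set {set 'I_n}}) : {set {set 'I_n}} :=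
  [set Psi in dsubsets n d |
    [forall i in Psi, forall j in Psi, (i != j) ==> ([set i; j] \in A)]].

Definition symdiff (T : finType) (A B : {set T}) : {set T} :=
  (A :\: B) :|: (B :\: A).

(* Probability that the random subset of V including each x \in V
   independently with probability w x equals S, for S \subset V. *)
Definition random_subset_pmf (R : realType) (T : finType) (V : {set T})
    (w : T -> R) (S : {set T}) : R :=
  \prod_(x in V) (if x \in S then w x else 1 - w x).

Definition hypergraph_pmf (R : realType) (n d : nat) (s : R)
    (H : {set {set 'I_n}}) : R :=
  random_subset_pmf (dsubsets n d) (fun=> s) H.

Definition graph_cond_pmf (R : realType) (n : nat) (p q : R)
    (H A : {set {set 'I_n}}) : R :=
  random_subset_pmf (dsubsets n 2)
    (fun e => if e \in projection H then p else q) A.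

Definition expectation_noisy_projection (R : realType) (n d : nat) (s p q : R)
    (X : {set {set 'I_n}} -> {set {set 'I_n}} -> R) : R :=
  \sum_(H in powerset (dsubsets n d)) \sum_(A in powerset (dsubsets n 2))
    hypergraph_pmf d s H * graph_cond_pmf p q H A * X H A.

Definition expected_error (R : realType) (n d : nat) (s p q : R) : R :=
  @expectation_noisy_projection R n d s p q
    (fun H A => #|symdiff (cliques d A) H|%:R).

Local Open Scope classical_set_scope.
Local Open Scope ring_scope.

(* u_n = n^(a + o(1)) as n tends to infinity *)
Definition pow_o1 (R : realType) (u : nat -> R) (a : R) : Prop :=
  exists2 e : nat -> R, e n @[n --> \oo] --> (0 : R) &
    \forall n \near \oo, u n = n%:R `^ (a + e n).

(* u_n = Omega(1) as n tends to infinity *)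
Definition Omega1 (R : realType) (u : nat -> R) : Prop :=
  exists2 c : R, 0 < c & \forall n \near \oo, c <= u n.

(* Main.v *)
(** A planted hyperedge is missed with probability 1 - p^C, C = 'C(d, 2), so
    everything rests on showing that a d-set Psi outside H is a clique with
    probability o(s). Choose t = n^-rho with t^C = o(s), but with rho so close
    to the cost (d - 1 - delta) / C per pair that q <= t and
    n^(d - k) s <= t^'C(k, 2) for 2 <= k < d; the hypotheses on beta and delta
    are exactly what makes this possible. Given H, each pair of Psi is an edge
    with probability at most t, times 1/t if it is covered, so Psi is a clique
    with probability at most t^C times the product over h in H of
    t^-'C(|h :&: Psi|, 2). By independence and 1 + x <= e^x the expectation of
    this product is at most exp(sum_h s t^-'C(|h :&: Psi|, 2)), and grouping h
    by its trace on Psi bounds the exponent by the number 2^d of traces. *)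
Require Import Defs.
From HB Require Import structures.
From mathcomp Require Import all_boot all_order all_algebra.
From mathcomp Require Import all_classical all_reals all_analysis.
From mathcomp Require Import ring lra.
Import Order.TTheory GRing.Theory Num.Theory.
Import numFieldNormedType.Exports.
Set Implicit Arguments.
Unset Strict Implicit.
Unset Printing Implicit Defensive.
Local Open Scope ring_scope.

(** * Random subsets and products over a ground set *)

Lemma sum_powerset_prod (R : realType) (T : finType) (V : {set T})
    (f g : T -> R) :
  \sum_(S in powerset V) \prod_(x in V) (if x \in S then f x else g x) =
  \prod_(x in V) (f x + g x).
Proof.
rewrite [RHS]big_mkcond /=.
under [RHS]eq_bigr => x _.
  rewrite (_ : (if _ then _ else _) =
    (if x \in V then f x else 0) + (if x \in V then g x else 1)); last first.
    by case: ifP => _ //; rewrite add0r.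
  over.
rewrite bigA_distr big_mkcond /=; apply: eq_bigr => S _.
rewrite powersetE; case: ifPn => [SV|/subsetPn[x xS xV]].
  rewrite big_mkcond /=; apply: eq_bigr => x _.
  case: (boolP (x \in S)) => // xS.
  by rewrite (fintype.subsetP SV).
by rewrite (bigD1 x) //= xS (negPf xV) mul0r.
Qed.

Lemma bin_leq_expn (n k : nat) : ('C(n, k) <= n ^ k)%N.
Proof.
apply: (@leq_trans (n ^_ k)); first by rewrite -bin_ffact leq_pmulr ?fact_gt0.
elim: k => // k IH.
by rewrite ffactnSr expnSr leq_mul // leq_subr.
Qed.

Lemma random_subset_pmf_ge0 (R : realType) (T : finType) (V : {set T})
    (w : T -> R) (S : {set T}) :
  (forall x, 0 <= w x <= 1) -> 0 <= random_subset_pmf V w S.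
Proof.
move=> w01; apply: prodr_ge0 => x _.
by have /andP[w0 w1] := w01 x; case: ifP => _ //; rewrite subr_ge0.
Qed.

Lemma random_subset_prob_superset (R : realType) (T : finType)
    (V E : {set T}) (w : T -> R) : E \subset V ->
  \sum_(S in powerset V) random_subset_pmf V w S * (E \subset S)%:R =
  \prod_(x in E) w x.
Proof.
move=> EV.
transitivity (\prod_(x in V) (w x + (1 - w x) * (x \notin E)%:R)).
  rewrite -sum_powerset_prod; apply: eq_bigr => S _.
  (* The indicator is put in product form over [V], so that its product with the pmf still factors
     over [V]. *)
  have -> : (E \subset S)%:R =
      \prod_(x in V) (if x \in S then 1 else (x \notin E)%:R) :> R.
    case: (boolP (E \subset S)) => [ES|/subsetPn[x xE xS]].
      rewrite big1 // => x _; case: ifPn => // xS.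
      by rewrite (contra (fintype.subsetP ES x) xS).
    by rewrite (bigD1 x) ?(fintype.subsetP EV) //= (negPf xS) xE mul0r.
  rewrite -big_split /=; apply: eq_bigr => x _.
  by case: ifP; rewrite ?mulr1.
rewrite big_mkcond [RHS]big_mkcond /=; apply: eq_bigr => x _.
case: (boolP (x \in E)) => xE; first by rewrite (fintype.subsetP EV) // mulr0 addr0.
by case: ifP => // _; rewrite mulr1 addrC subrK.
Qed.

(** * Cliques and errors in terms of pairs *)

Definition pairs_in (n : nat) (Psi : {set 'I_n}) : {set {set 'I_n}} :=
  [set e in dsubsets n 2 | e \subset Psi].

Lemma pairs_in_sub (n : nat) (Psi : {set 'I_n}) :
  pairs_in Psi \subset dsubsets n 2.
Proof. by apply/fintype.subsetP => e; rewrite inE => /andP[]. Qed.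

Lemma card_pairs_in (n : nat) (Psi : {set 'I_n}) :
  #|pairs_in Psi| = 'C(#|Psi|, 2).
Proof.
rewrite -cards_draws; apply: eq_card => e.
by rewrite !inE andbC.
Qed.

Lemma mem_cliques (n d : nat) (A : {set {set 'I_n}}) (Psi : {set 'I_n}) :
  (Psi \in cliques d A) = (Psi \in dsubsets n d) && (pairs_in Psi \subset A).
Proof.
rewrite inE; congr (_ && _); apply/idP/idP.
  move=> /forall_inP cl; apply/fintype.subsetP => e; rewrite !inE => /andP[].
  move=> /cards2P[i [j [ij ->]]]; rewrite finset.subUset !finset.sub1set => /andP[iP jP].
  by have /forall_inP/(_ _ jP) := cl _ iP; rewrite ij.
move=> /fintype.subsetP PA; apply/forall_inP => i iP; apply/forall_inP => j jP.
apply/implyP => ij; apply: PA.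
by rewrite !inE cards2 ij finset.subUset !finset.sub1set iP jP.
Qed.

Lemma card_symdiff_cliques (R : realType) (n d : nat)
    (H A : {set {set 'I_n}}) : H \subset dsubsets n d ->
  #|symdiff (cliques d A) H|%:R =
  \sum_(Psi in dsubsets n d)
    ((Psi \in H)%:R * (1 - (pairs_in Psi \subset A)%:R)
     + (Psi \notin H)%:R * (pairs_in Psi \subset A)%:R) :> R.
Proof.
move=> HV; rewrite -sum1_card natr_sum big_mkcond [RHS]big_mkcond /=.
apply: eq_bigr => Psi _; rewrite finset.in_setU !finset.in_setD mem_cliques.
case: (boolP (Psi \in dsubsets n d)) => PV /=; last first.
  by rewrite andbF /= (contraNF (fintype.subsetP HV Psi)).
case: (Psi \in H); case: (_ \subset _) => /=; ring.
Qed.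

(** * Bound on the expected error for fixed n *)

Section ErrorBound.
Variables (R : realType) (n d : nat) (s p q t : R).
Hypotheses (s01 : 0 <= s <= 1) (q0 : 0 <= q) (p0 : 0 <= p) (p1 : p <= 1).
Implicit Types (H A : {set {set 'I_n}}) (Psi h : {set 'I_n}).

Let w H (e : {set 'I_n}) : R := if e \in projection H then p else q.

(** Linearity over [Psi]. Given [H] the pairs are independent, so summing out [A] turns the clique
    indicator into the product of the conditional edge probabilities [w H e]. *)
Lemma expected_errorE :
  expected_error n d s p q =
  \sum_(Psi in dsubsets n d) \sum_(H in powerset (dsubsets n d))
    hypergraph_pmf d s H *
    ((Psi \in H)%:R * (1 - \prod_(e in pairs_in Psi) w H e)
     + (Psi \notin H)%:R * \prod_(e in pairs_in Psi) w H e).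
Proof.
rewrite [RHS]exchange_big /expected_error /expectation_noisy_projection /=.
apply: eq_bigr => H HV.
rewrite powersetE in HV.
under eq_bigr do rewrite card_symdiff_cliques // mulr_sumr.
rewrite exchange_big /=; apply: eq_bigr => Psi _.
(* The term free of [A] is given the trivial event [set0 \subset A], so that
   [random_subset_prob_superset] evaluates both sums. *)
under eq_bigr => A _.
  rewrite (_ : _ * _ = hypergraph_pmf d s H * (
    (Psi \in H)%:R * (graph_cond_pmf p q H A * (finset.set0 \subset A)%:R)
     + ((Psi \notin H)%:R - (Psi \in H)%:R) *
       (graph_cond_pmf p q H A * (pairs_in Psi \subset A)%:R))); last first.
    rewrite finset.sub0set /=; ring.
  over.
rewrite -mulr_sumr big_split /= -!mulr_sumr.
rewrite !random_subset_prob_superset ?pairs_in_sub ?finset.sub0set //.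
by rewrite finset.big_set0 /w; ring.
Qed.

Lemma prod_w_planted Psi H : Psi \in dsubsets n d -> Psi \in H ->
  \prod_(e in pairs_in Psi) w H e = p ^+ 'C(d, 2).
Proof.
rewrite inE => /eqP dP PH.
rewrite -dP -card_pairs_in -prodr_const; apply: eq_bigr => e.
rewrite inE => /andP[e2 eP]; rewrite /w !inE; case: ifP => //.
move: e2; rewrite inE => -> /= /negbT/exists_inPn/(_ _ PH).
by rewrite eP.
Qed.

Hypotheses (qt : q <= t) (t0 : 0 < t) (t1 : t <= 1).

(* Exponential Markov: each pair pays a factor [t], refunded by every
   hyperedge covering it; this decouples the pairs. *)
Lemma prod_w_le Psi H :
  \prod_(e in pairs_in Psi) w H e <=
  t ^+ 'C(#|Psi|, 2) * \prod_(h in H) t^-1 ^+ 'C(#|h :&: Psi|, 2).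
Proof.
have tV1 : 1 <= t^-1 by rewrite invf_ge1.
pose c (e h : {set 'I_n}) : R := if e \subset h then t^-1 else 1.
have c1 e h : 1 <= c e h by rewrite /c; case: ifP.
have -> : t ^+ 'C(#|Psi|, 2) * \prod_(h in H) t^-1 ^+ 'C(#|h :&: Psi|, 2) =
    \prod_(e in pairs_in Psi) (t * \prod_(h in H) c e h).
  rewrite big_split prodr_const card_pairs_in; congr (_ * _).
  rewrite exchange_big; apply: eq_bigr => h _ /=.
  rewrite -card_pairs_in -prodr_const big_mkcond [RHS]big_mkcond /=.
  apply: eq_bigr => e _; rewrite /c !inE finset.subsetI.
  by do 3 case: (_ \subset _) || case: (_ == _).
apply: ler_prod => e; rewrite inE => /andP[e2 eP].
have prod1 (P : pred {set 'I_n}) : 1 <= \prod_(h | P h) c e h.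
  by apply: (big_ind (fun x => 1 <= x)) => // x y; exact: mulr_ege1.
(* One hyperedge covering [e] cancels the factor [t]; all remaining factors are at least 1, hence at
   least [p]. *)
rewrite /w inE e2 /=; case: ifP => [/exists_inP[h hH eh]|_].
  rewrite p0 (bigD1 h) //= mulrA {1}/c eh mulfV ?gt_eqF // mul1r.
  exact: le_trans p1 (prod1 _).
by rewrite q0 (le_trans qt)// ler_peMr// ltW.
Qed.

Hypothesis cover : forall k, (2 <= k < d)%N ->
  n%:R ^+ (d - k) * s <= t ^+ 'C(k, 2).

(** Once the trace [S] is fixed, [h] is determined by [h :\: S], which has [d - #|S|] elements. *)
Lemma card_trace_le Psi (S : {set 'I_n}) :
  (#|[set h in dsubsets n d | h :&: Psi == S]| <= n ^ (d - #|S|))%N.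
Proof.
set B := [set h in _ | _].
have -> : #|B| = #|[set h :\: S | h in B]|.
  rewrite card_in_imset // => h h'; rewrite !inE.
  move=> /andP[_ /eqP hS] /andP[_ /eqP h'S] eh.
  by rewrite -(finset.setID h S) -(finset.setID h' S) eh -{1}hS -{1}h'S
    finset.setIA finset.setIid -[in RHS]h'S finset.setIA finset.setIid hS h'S.
apply: (@leq_trans 'C(n, d - #|S|)).
  rewrite -[X in 'C(X, _)]card_ord -card_draws; apply: subset_leq_card.
  apply/fintype.subsetP => _ /finset.imsetP[h + ->]; rewrite !inE.
  move=> /andP[/eqP <- /eqP hS].
  have Sh : S \subset h by rewrite -hS finset.subsetIl.
  by rewrite cardsD (finset.setIidPr Sh).
exact: bin_leq_expn.
Qed.

(** Each trace contributes at most 1: by [card_trace_le] and [cover], the entropy of the hyperedges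
    with a trace of size k is paid for by [s] and [t ^+ 'C(k, 2)]. *)
Lemma sum_cover_le Psi : Psi \in dsubsets n d ->
  \sum_(h in dsubsets n d | (h != Psi) && (1 < #|h :&: Psi|)%N)
    s * t^-1 ^+ 'C(#|h :&: Psi|, 2) <= (2 ^ d)%:R.
Proof.
rewrite inE => /eqP dP; have /andP[s0 s1] := s01.
have tV0 : 0 <= t^-1 by rewrite invr_ge0 ltW.
rewrite (partition_big (fun h => h :&: Psi) (mem (powerset Psi))) /=; last first.
  by move=> h _; rewrite powersetE finset.subsetIr.
have -> : (2 ^ d)%:R = \sum_(S in powerset Psi) 1 :> R.
  by rewrite -dP -card_powerset -sum1_card natr_sum.
apply: ler_sum => S SP.
(* Traces of size below 2 are excluded from the sum, and a trace of size [d] would force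
   [h = Psi]. *)
case: (boolP (1 < #|S| < d)%N) => Sd; last first.
  rewrite big1 // => h /andP[/andP[hV /andP[hP h1]] /eqP hS].
  move: Sd; rewrite -hS h1 /= -leqNgt => dh.
  move: hP; rewrite inE in hV.
  have: h :&: Psi == h by rewrite eqEcard finset.subsetIl /= (eqP hV).
  have: h :&: Psi == Psi by rewrite eqEcard finset.subsetIr /= dP.
  by move=> /eqP -> /eqP ->; rewrite eqxx.
apply: (@le_trans _ _ (\sum_(h in [set h in dsubsets n d | h :&: Psi == S])
   s * t^-1 ^+ 'C(#|S|, 2))).
  rewrite [leLHS]big_mkcond [leRHS]big_mkcond /=; apply: ler_sum => h _.
  rewrite !inE; case: ifP => [/andP[/andP[-> _] hS]|_].
    by rewrite hS (eqP hS).
  by case: ifP => // _; rewrite mulr_ge0 ?exprn_ge0.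
rewrite sumr_const -mulr_natl mulrA exprVn ler_pdivrMr ?exprn_gt0 // mul1r.
apply: le_trans (cover Sd).
by rewrite ler_wpM2r // -natrX ler_nat card_trace_le.
Qed.

(** The bound of [prod_w_le] is a product over hyperedges, so its mean over [H] factors into terms
    [s * a h + (1 - s)]. *)
Lemma prob_spurious_clique_le Psi : Psi \in dsubsets n d ->
  \sum_(H in powerset (dsubsets n d)) hypergraph_pmf d s H *
    ((Psi \notin H)%:R * \prod_(e in pairs_in Psi) w H e) <=
  t ^+ 'C(d, 2) * expR (2 ^ d)%:R.
Proof.
move=> PV; have := PV; rewrite inE => /eqP dP; have /andP[s0 s1] := s01.
have t0' := ltW t0.
(* The value 0 at [Psi] encodes the event that [Psi] is not in [H]. *)
pose a h : R := (h != Psi)%:R * t^-1 ^+ 'C(#|h :&: Psi|, 2).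
have a0 h : 0 <= a h by rewrite mulr_ge0 // exprn_ge0 ?invr_ge0.
have pmf0 H : 0 <= hypergraph_pmf d s H by apply: random_subset_pmf_ge0.
apply: (@le_trans _ _ (t ^+ 'C(d, 2) * \prod_(h in dsubsets n d)
    (s * a h + (1 - s)))).
  rewrite -sum_powerset_prod mulr_sumr; apply: ler_sum => H.
  rewrite powersetE => HV.
  have -> : \prod_(h in dsubsets n d) (if h \in H then s * a h else 1 - s) =
      hypergraph_pmf d s H * \prod_(h in H) a h.
    rewrite [X in _ * X]big_mkcond /= [in LHS]big_mkcond.
    rewrite [X in X * _]big_mkcond -big_split /=; apply: eq_bigr => h _.
    case: (boolP (h \in H)) => hH; first by rewrite (fintype.subsetP HV).
    by rewrite mulr1.
  rewrite [leRHS]mulrCA ler_wpM2l //.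
  case: (boolP (Psi \in H)) => PH /=.
    by rewrite mul0r mulr_ge0 ?exprn_ge0 ?prodr_ge0.
  rewrite mul1r (le_trans (prod_w_le Psi H)) // dP ler_wpM2l ?exprn_ge0 //.
  apply: ler_prod => h hH; rewrite exprn_ge0 ?invr_ge0 //= /a.
  by rewrite (_ : h != Psi) ?mul1r //; apply: contraNneq PH => <-.
rewrite ler_wpM2l ?exprn_ge0 //.
(* Only hyperedges other than [Psi] sharing a pair with it enter the exponent: [Psi] itself gives
   the factor [1 - s], at most 1, and a trace of size at most 1 gives exactly 1. *)
apply: (@le_trans _ _ (expR (\sum_(h in dsubsets n d |
   (h != Psi) && (1 < #|h :&: Psi|)%N) s * t^-1 ^+ 'C(#|h :&: Psi|, 2)))); last first.
  by rewrite ler_expR sum_cover_le.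
rewrite big_mkcondr /= expR_sum; apply: ler_prod => h _.
rewrite addr_ge0 ?subr_ge0 ?(mulr_ge0 s0 (a0 h)) //= /a.
case: (eqVneq h Psi) => [_|_] /=; first by rewrite mul0r mulr0 add0r expR0 gerBl.
case: (ltnP 1) => h1; last first.
  by rewrite bin_small // expr0 !mulr1 expR0 addrC subrK.
rewrite mul1r; apply: le_trans (expR_ge1Dx _).
by rewrite addrC lerD2r gerBl.
Qed.

Lemma expected_error_ge0 : q <= 1 -> 0 <= expected_error n d s p q.
Proof.
move=> q1; rewrite /expected_error /expectation_noisy_projection.
apply: sumr_ge0 => H _; apply: sumr_ge0 => A _; rewrite !mulr_ge0 //.
  exact: random_subset_pmf_ge0.
by apply: random_subset_pmf_ge0 => e; case: ifP => _; rewrite ?p0 ?p1 ?q0 ?q1.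
Qed.

Lemma expected_error_le :
  expected_error n d s p q <=
  'C(n, d)%:R * (s * (1 - p ^+ 'C(d, 2)) + t ^+ 'C(d, 2) * expR (2 ^ d)%:R).
Proof.
rewrite expected_errorE -[X in 'C(X, _)]card_ord -card_draws mulr_natl.
rewrite -sumr_const; apply: ler_sum => Psi PV.
under eq_bigr do rewrite mulrDr.
rewrite big_split /= lerD ?prob_spurious_clique_le //.
(* The event that [Psi] lies in [H] is read as [[set Psi] \subset H], of probability [s]. *)
under eq_bigr => H _.
  rewrite (_ : hypergraph_pmf _ _ _ * _ = (1 - p ^+ 'C(d, 2)) *
    (hypergraph_pmf d s H * ([set Psi] \subset H)%:R)); last first.
    rewrite finset.sub1set; case: (boolP (Psi \in H)) => PH /=; last by ring.
    by rewrite prod_w_planted //; ring.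
  over.
rewrite -mulr_sumr random_subset_prob_superset ?finset.sub1set //.
by rewrite finset.big_set1 mulrC.
Qed.
End ErrorBound.

(** * Choice of the exponents *)

Lemma natr_bin2 (R : realType) (k : nat) :
  'C(k, 2)%:R = k%:R * (k%:R - 1) / 2 :> R.
Proof.
have: ('C(k, 2) * 2 = k * k.-1)%N by rewrite (bin_ffact k 2) ffactnS ffactn1.
move=> /(congr1 (fun m => m%:R : R)); rewrite !natrM.
case: k => [|k]; first by rewrite !mul0r.
by rewrite -[k%:R](addrK 1) natr1 => <-; rewrite mulfK.
Qed.

(* [(d - 1 - delta) / 'C(d, 2)] is the cost of one pair in an edge of the
   hypergraph. Covering a clique of size [d] pairwise by proper traces of size
   [k] or by noise is strictly costlier per pair, so any [rho] slightly above
   this value works. *)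
Lemma pair_exponent (R : realType) (d : nat) (delta beta : R) :
  (2 <= d)%N -> 0 <= delta -> delta < (d%:R - 1) / (d%:R + 1) ->
  beta < 2 * delta / (d%:R * (d%:R - 1)) + (d%:R - 2) / d%:R ->
  exists rho eps : R, [/\ 0 < eps, 0 <= rho, - 1 + beta + eps <= - rho,
    forall k, (2 <= k < d)%N ->
      (d - k)%:R + (- (d%:R - 1) + delta + eps) <= - rho * 'C(k, 2)%:R &
    - rho * 'C(d, 2)%:R + eps <= - (d%:R - 1) + delta - eps].
Proof.
move=> d2 delta0; set D : R := d%:R => hdelta hbeta.
have D2 : 2 <= D by rewrite /D ler_nat.
have DD : 0 < D * (D - 1) by rewrite mulr_gt0; lra.
have D0 : D != 0 by lra.
have D10 : D - 1 != 0 by lra.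
rewrite ltr_pdivlMr in hdelta; last lra.
have delta1 : delta < 1 by nra.
(* This is the cost per pair [(D - 1 - delta) / 'C(d, 2)]; the hypothesis on [beta] says exactly
   [w < 1 - beta]. *)
pose w := 2 * (D - 1 - delta) / (D * (D - 1)).
have w0 : 0 < w by rewrite divr_gt0 //; lra.
have g0 : 0 < 1 - beta - w.
  suff -> : 1 - beta - w =
    2 * delta / (D * (D - 1)) + (D - 2) / D - beta by lra.
  by rewrite /w; field; rewrite ?D0 ?D10.
(* A lower bound for the slack over all k: in [KE] below, [D - K] is at least 1 and the other factor
   of the numerator is smallest at [K = 2], where it is positive by the hypothesis on [delta]. *)
pose eta := ((D - 1) - delta * (D + 1)) / (D * (D - 1)).
have eta0 : 0 < eta by rewrite divr_gt0 //; lra.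
pose m := Num.min (1 - beta - w) eta.
have m0 : 0 < m by rewrite lt_min g0.
have mg : m <= 1 - beta - w by rewrite ge_min lexx.
have me : m <= eta by rewrite ge_min lexx orbT.
have DD4 : 4 <= D * D by nra.
(* With [rho = w + x] and [eps = x / 2], the loss [x * 'C(k, 2)] is at most [m / 2] and the [eps]
   terms fit in the rest of the slack [m]. In the last inequality [x * 'C(d, 2)] pays for both
   copies of [eps]. *)
pose x := m / (D * D).
have xE : x * (D * D) = m by rewrite /x mulfVK //; nra.
have x0 : 0 < x by rewrite divr_gt0 //; nra.
have x4 : x * 4 <= m by rewrite -xE ler_pM2l.
exists (w + x), (x / 2); split.
- lra.
- lra.
- lra.
- move=> k /andP[k2 kd]; rewrite natr_bin2 natrB ?(ltnW kd) // -/D.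
  set K : R := k%:R.
  have K2 : 2 <= K by rewrite /K ler_nat.
  have KD : K + 1 <= D by rewrite /K /D natr1 ler_nat.
  have KE : K - 1 - delta - w * (K * (K - 1) / 2) =
      (D - K) * ((K - 1) * (D - 1) - delta * (D + K - 1)) / (D * (D - 1)).
    by rewrite /w; field; rewrite ?D0 ?D10.
  have : eta <= K - 1 - delta - w * (K * (K - 1) / 2).
    rewrite KE /eta ler_pM2r ?invr_gt0 //.
    have : 0 <= (K - 2) * (D - 1 - delta) by rewrite mulr_ge0; lra.
    set b := (K - 1) * (D - 1) - _ => hb.
    have b0 : D - 1 - delta * (D + 1) <= b by rewrite /b; lra.
    by rewrite (le_trans b0)// ler_peMl; lra.
  have : x * (K * (K - 1) / 2) <= x * (D * D / 2).
    by rewrite ler_pM2l //; nra.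
  lra.
- rewrite natr_bin2 -/D.
  have wE : w * (D * (D - 1) / 2) = D - 1 - delta.
    by rewrite /w; field; rewrite ?D0 ?D10.
  have : x * 1 <= x * (D * (D - 1) / 2) by rewrite ler_pM2l //; nra.
  lra.
Qed.

(** * Asymptotics *)

Local Open Scope classical_set_scope.
Local Open Scope ring_scope.

Lemma near_powR_ge (R : realType) (eps K : R) : 0 < eps ->
  \forall n \near \oo, K <= n%:R `^ eps.
Proof.
move=> eps0; near=> n.
have n1 : 1 <= n%:R :> R by near: n; exact: nbhs_infty_ger.
apply: (@le_trans _ _ (Num.max K 1)); first by rewrite le_max lexx.
have M0 : 0 <= Num.max K 1 by rewrite le_max ler01 orbT.
have -> : Num.max K 1 = (Num.max K 1 `^ eps^-1) `^ eps.
  by rewrite -powRrM mulVf ?gt_eqF // powRr1.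
rewrite ge0_ler_powR ?nnegrE ?powR_ge0 ?(ltW eps0) //.
by near: n; exact: nbhs_infty_ger.
Unshelve. all: by end_near. Qed.

(** Serves both regimes of [p]: spurious cliques are absorbed in an arbitrarily small [kappa], which
    leaves only the missed fraction [1 - p n ^+ 'C(d, 2)]. *)
Lemma near_expected_error_le (R : realType) (d : nat) (delta beta : R)
  (s p q : nat -> R) :
  (2 <= d)%N -> 0 <= delta -> delta < (d%:R - 1) / (d%:R + 1) ->
  beta < 2 * delta / (d%:R * (d%:R - 1)) + (d%:R - 2) / d%:R ->
  (forall n, 0 <= s n <= 1) -> (forall n, 0 <= q n) ->
  (forall n, q n <= p n) -> (forall n, p n <= 1) ->
  pow_o1 s (- (d%:R - 1) + delta) -> pow_o1 q (- 1 + beta) ->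
  forall kappa : R, 0 < kappa -> \forall n \near \oo,
    expected_error n d (s n) (p n) (q n) <=
    (1 - p n ^+ 'C(d, 2) + kappa) * (s n * 'C(n, d)%:R).
Proof.
move=> d2 delta0 hdelta hbeta s01 q0 qp p1 [es es0 sE] [eq eq0 qE] kappa k0.
have [rho [eps [eps0 rho0 hq hcover hbase]]] :=
  pair_exponent d2 delta0 hdelta hbeta.
near=> n.
have n1 : 1 <= n%:R :> R by near: n; exact: nbhs_infty_ger.
have n0 : 0 < n%:R :> R by lra.
have nD x y : n%:R `^ (x + y) = n%:R `^ x * n%:R `^ y :> R.
  by rewrite powRD //; apply/implyP => _; rewrite gt_eqF.
have esn : `|es n| <= eps by near: n; exact: cvgr0_norm_le.
have eqn : `|eq n| <= eps by near: n; exact: cvgr0_norm_le.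
have sn : s n = n%:R `^ (- (d%:R - 1) + delta + es n) by near: n.
have qn : q n = n%:R `^ (- 1 + beta + eq n) by near: n.
have Kn : expR (2 ^ d)%:R / kappa <= n%:R `^ eps.
  by near: n; exact: near_powR_ge.
move: esn eqn; rewrite !ler_norml => /andP[esl esu] /andP[_ equ].
pose t : R := n%:R `^ (- rho).
have tX m : t ^+ m = n%:R `^ (- rho * m%:R).
  by rewrite powRrM powR_mulrn // powR_ge0.
have t0 : 0 < t by rewrite powR_gt0.
have t1 : t <= 1 by rewrite -[leRHS](powRr0 n%:R) ler_powR // oppr_le0.
have qt : q n <= t by rewrite qn ler_powR //; lra.
have cover k : (2 <= k < d)%N -> n%:R ^+ (d - k) * s n <= t ^+ 'C(k, 2).
  move=> kd; rewrite tX -powR_mulrn ?ler0n // sn -nD ler_powR //.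
  by apply: le_trans (hcover k kd); lra.
have p0 : 0 <= p n := le_trans (q0 n) (qp n).
apply: le_trans (expected_error_le (s01 n) (q0 n) p0 (p1 n) qt t0 t1 cover) _.
rewrite mulrA [leLHS]mulrC ler_wpM2r ?ler0n //.
rewrite mulrDl lerD //; first by rewrite mulrC.
(* Of the two [eps] in [hbase], one absorbs the o(1) in the exponent of [s] and the other yields the
   factor that beats [expR (2 ^ d)%:R / kappa]. *)
have tC : n%:R `^ eps * t ^+ 'C(d, 2) <= s n.
  by rewrite tX sn -nD ler_powR //; lra.
rewrite ler_pdivrMr // in Kn.
apply: (@le_trans _ _ (t ^+ 'C(d, 2) * (n%:R `^ eps * kappa))).
  by rewrite ler_wpM2l // exprn_ge0 // ltW.
rewrite mulrA [X in X * _]mulrC [leRHS]mulrC ler_wpM2r // ltW //.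
Unshelve. all: by end_near. Qed.

Theorem proposition2p7 (R : realType) (d : nat) (delta beta : R)
  (s p q : nat -> R)
  (hd : (2 <= d)%N)
  (hdelta0 : 0 <= delta)
  (hdelta : delta < (d%:R - 1) / (d%:R + 1))
  (hbeta : beta < 2 * delta / (d%:R * (d%:R - 1)) + (d%:R - 2) / d%:R)
  (hs01 : forall n, 0 <= s n <= 1)
  (hq0 : forall n, 0 <= q n)
  (hqp : forall n, q n <= p n)
  (hp1 : forall n, p n <= 1)
  (hs : pow_o1 s (- (d%:R - 1) + delta))
  (hq : pow_o1 q (- 1 + beta)) :
  (p n @[n --> \oo] --> (1 : R) ->
     (fun n : nat => expected_error n d (s n) (p n) (q n) : R^o)
       =o_\oo (fun n : nat => s n * 'C(n, d)%:R : R^o))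
  /\
  (Omega1 p ->
     exists2 c : R, 0 < c &
       \forall n \near \oo,
         expected_error n d (s n) (p n) (q n) <= (1 - c) * (s n * 'C(n, d)%:R)).
Proof.
have main := near_expected_error_le hd hdelta0 hdelta hbeta hs01 hq0 hqp hp1 hs hq.
have N0 n : 0 <= s n * 'C(n, d)%:R.
  by rewrite mulr_ge0 ?ler0n //; have /andP[] := hs01 n.
split.
  move=> p_to1; apply/eqoP => eps eps0.
  (* Half of [eps] is for spurious cliques, half for missed hyperedges. *)
  have eps2 : 0 < eps / 2 by rewrite divr_gt0.
  have pC : p n ^+ 'C(d, 2) @[n --> \oo] --> (1 : R).
    have := @exprn_continuous R 'C(d, 2) 1; rewrite /continuous_at expr1n.
    exact: cvg_comp p_to1.
  near=> n.
  have p0 : 0 <= p n := le_trans (hq0 n) (hqp n).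
  rewrite [X in X <= _]ger0_norm; last first.
    apply: expected_error_ge0 => //; exact: le_trans (hqp n) (hp1 n).
  rewrite [X in _ * X]ger0_norm //.
  have le1 := near (main _ eps2) n; apply: le_trans (le1 _) _ => //.
  rewrite ler_wpM2r //.
  suff : 1 - eps / 2 <= p n ^+ 'C(d, 2) by lra.
  by near: n; apply: (cvgr_ge _ pC); lra.
move=> [c c0 pc].
(* At least a fraction [c ^+ 'C(d, 2)] of planted hyperedges is recovered on average; spurious
   cliques may consume half of this gain. *)
have cC : 0 < c ^+ 'C(d, 2) / 2 by rewrite divr_gt0 // exprn_gt0.
exists (c ^+ 'C(d, 2) / 2) => //.
near=> n.
apply: (@le_trans _ _ ((1 - p n ^+ 'C(d, 2) + c ^+ 'C(d, 2) / 2)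
    * (s n * 'C(n, d)%:R))); first by near: n; exact: main.
rewrite ler_wpM2r //.
suff : c ^+ 'C(d, 2) <= p n ^+ 'C(d, 2) by lra.
by rewrite lerXn2r ?nnegrE ?(ltW c0) ?(le_trans (hq0 n)) //; near: n.
Unshelve. all: by end_near. Qed.
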